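(* Let $(X,d)$ be a compact metric space, let $\mu$ be a Borel probability measure on $X$, and let $f: X\to X$ be a homeomorphism. If $f$ is pairwise sensitive with respect to $\mu$, then the set of points of $X$ with converging semi-orbits under $f$ has $\mu$-measure $0$.
   Context: Pairwise sensitivity: a homeomorphism $f:X\to X$ of a compact metric space $(X,d)$ is pairwise sensitive with respect to a Borel probability measure $\mu$ on $X$ if there is $\delta>0$ such that for $\mu\otimes\mu$-a.e. $(x,y)\in X\times X$ there is $n\in\mathbb{Z}$ with $d(f^n(x),f^n(y))\geq\delta$. The measure $\mu$ is not assumed to be $f$-invariant. Converging semi-orbits: for $z\in X$, let $\alpha(z)$ be the set of points $y\in X$ such that $y=\lim_{j\to\infty} f^{n_j}(z)$ for some sequence of integers $n_j\to\infty$, and let $\omega(z)$ be defined similarly with sequences of integers $n_j\to-\infty$. The point $z$ has converging semi-orbits under $f$ if $\alpha(z)$ and $\omega(z)$ each consist of a single point (the two points may be different). *)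

(* Defs.v *)
From HB Require Import structures.
From mathcomp Require Import all_boot all_order all_algebra.
From mathcomp Require Import all_classical all_reals all_analysis.

Set Implicit Arguments.
Unset Strict Implicit.
Unset Printing Implicit Defensive.

Import Order.TTheory GRing.Theory Num.Theory.

Local Open Scope classical_set_scope.
Local Open Scope ring_scope.

(* [measurableType] requires a [pointedType], which [metricType] is not. This
   excludes only the empty space, which carries no probability measure. *)
#[short(type="pmetricType")]
HB.structure Definition PointedMetric (K : numDomainType) :=
  { M of Metric K M & Pointed M }.

Notation borel X := (g_sigma_algebraType (@open X)).

(* The inverse [f^-1] is part of the [splitbij] structure of [f]. *)
Definition homeomorphism {X : topologicalType}
    (f : {splitbij [set: X] >-> [set: X]}) : Prop :=
  continuous f /\ continuous (f^-1)%FUN.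

Definition iterz {X : Type} (f : {splitbij [set: X] >-> [set: X]}) (n : int)
    : X -> X :=
  match n with
  | Posz m => iter m f
  | Negz m => iter m.+1 (f^-1)%FUN
  end.

Section Dynamics.
Context {R : realType} {X : pmetricType R}.
Implicit Types (f : {splitbij [set: X] >-> [set: X]}) (z : X).

Definition pairwise_sensitive f (mu : probability (borel X) R) : Prop :=
  exists2 delta : R, 0 < delta &
    {ae (mu \x mu)%E, forall p : borel X * borel X,
      exists n : int, delta <= mdist (iterz f n p.1) (iterz f n p.2)}.

(* [alpha_limit] is about n_j -> +oo and [omega_limit] about n_j -> -oo, which
   is the opposite of the usual convention. *)
Definition alpha_limit f z : set X :=
  [set y | exists2 n : nat -> int,
     (forall m : int, \forall j \near \oo, m <= n j) &
     (fun j => iterz f (n j) z) @ \oo --> y].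

Definition omega_limit f z : set X :=
  [set y | exists2 n : nat -> int,
     (forall m : int, \forall j \near \oo, n j <= m) &
     (fun j => iterz f (n j) z) @ \oo --> y].

Definition converging_semi_orbits f z : Prop :=
  (exists a, alpha_limit f z = [set a]) /\
  (exists b, omega_limit f z = [set b]).

End Dynamics.

(* Main.v *)
Require Import Defs.
From mathcomp Require Import all_boot all_order all_algebra.
From mathcomp Require Import all_classical all_reals all_analysis.
From mathcomp Require Import finmap lra.

(* In a compact space, z has converging semi-orbits iff both semi-orbits of z
   converge, i.e. iff at every scale r both of them are shadowed within r by an
   eventually constant sequence in a fixed finite r-net. There are only countably
   many such sequences, which gives measurability. Let E be the set of points
   whose semi-orbits are shadowed by two given sequences: the whole orbits of any
   two points of E stay less than 2r apart, so when 2r <= delta the square E x E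
   is null by pairwise sensitivity, hence mu(E)^2 = 0, and E is null. *)

Import Order.TTheory GRing.Theory Num.Theory.

Local Open Scope classical_set_scope.
Local Open Scope ring_scope.

Section MetricSpace.
Context {R : realType} {X : pmetricType R}.
Implicit Types (u : nat -> X) (x y : X).

Lemma open_metric_ball x (r : R) : open (ball x r).
Proof.
rewrite openE => y; rewrite ballEmdist /= => xyr.
rewrite /interior -nbhs_ballE /=.
exists (r - mdist x y); first by rewrite /= subr_gt0.
move=> z; rewrite /= !ballEmdist /= => yz.
by rewrite (le_lt_trans (metric_triangle x y z))// addrC -ltrBrDr.
Qed.

Lemma compact_ball_net (r : R) : compact [set: X] -> 0 < r ->
  exists c : nat -> X, forall y, exists i, ball (c i) r y.
Proof.
rewrite compact_cover => cX r0.
have [|y _|D _ DX] := cX X setT (fun x => ball x r).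
- by move=> x _; exact: open_metric_ball.
- by exists y => //; exact: ballxx.
(* The finite net is padded with [point] to a sequence over all of [nat], so that its centres are
   named by plain natural numbers. *)
- exists (fun i => nth point (enum_fset D) i) => y.
  have [x /= xD xy] := DX y I.
  by exists (index x (enum_fset D)); rewrite nth_index.
Qed.

(** Compactness forces convergence to a unique cluster point; conversely, metric spaces being
    Hausdorff, a limit is the only cluster point. *)
Lemma cluster_set1_cvgn u : compact [set: X] ->
  (exists l, cluster (u @ \oo) = [set l]) <-> cvg (u @ \oo).
Proof.
move=> cX; split=> [[l ul]|/cvg_ex[l /= ul]].
  apply/cvg_ex; exists l.
  by apply: (@compact_cluster_set1 X l _ setT) => //;
    [exact: metric_hausdorff | exact: filterT | exact: filterT].
exists l; apply/seteqP; split=> [y uy|_ -> A B uA lB].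
  by apply/esym/metric_hausdorff; exact: cvg_cluster ul _ uy.
have uB : (u @ \oo) B by exact: ul.
exact: filter_ex (filterI uA uB).
Qed.

(** With [v] defined on all of [int], this serves forward orbits directly and backward orbits after
    time reversal. *)
Lemma subseq_limit_cluster (v : int -> X) y :
  (exists2 n : nat -> int, (forall m : int, \forall j \near \oo, m <= n j) &
     (fun j => v (n j)) @ \oo --> y) <->
  cluster ((fun k : nat => v k%:Z) @ \oo) y.
Proof.
split=> [[n noo nv] A B [N _ NA] yB|vy].
  have [j [Nj Bj]] : exists j, N%:Z <= n j /\ B (v (n j)).
    by apply: (@filter_ex _ \oo); apply: filterI (noo N%:Z) (nv _ yB).
  exists (v (n j)); split => //.
  by case: (n j) Nj => // k Nk; apply: NA.
(* The bound [j <= k] sends the chosen times to infinity, and the shrinking radius sends the chosen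
   points to [y]. *)
have /choice[n nP] j : exists k : nat, (j <= k)%N /\ ball y j.+1%:R^-1 (v k%:Z).
  have [||_ [[k jk <-] yk]] := vy [set v k%:Z | k in [set k | (j <= k)%N]]
      (ball y j.+1%:R^-1).
  - by exists j => // k /= jk; exists k.
  - by apply: nbhsx_ballx; rewrite invr_gt0.
  - by exists k.
exists (fun j => (n j)%:Z) => [m|].
  exists `|m|%N => // j /= mj.
  apply: le_trans (lez_abs m) _.
  by rewrite lez_nat; apply: leq_trans mj (nP j).1.
apply/cvg_ballP => e e0.
near=> j.
apply: (le_ball (e1 := j.+1%:R^-1)); last exact: (nP j).2.
apply/ltW; near: j.
exact: (near_infty_natSinv_lt (PosNum e0)).
Unshelve. all: by end_near. Qed.

(* [(i, s)] codes the eventually constant sequence [s_0, s_1, ..., i, i, ...]. *)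
Definition itinerary (p : nat * seq nat) (n : nat) : nat := nth p.1 p.2 n.

(** A limit lies in some ball of the net, which captures a tail; the finitely many earlier terms are
    coded one by one. Conversely, tails lie in arbitrarily small balls, so a cluster point, given by
    compactness, is the limit. *)
Lemma cvgn_itinerary (c : nat -> nat -> X) u : compact [set: X] ->
  (forall k y, exists i, ball (c k i) k.+1%:R^-1 y) ->
  cvg (u @ \oo) <->
  forall k, exists p, forall n, ball (c k (itinerary p n)) k.+1%:R^-1 (u n).
Proof.
move=> cX cnet; split=> [/cvg_ex[l /= ul] k|up].
  have [i cl] := cnet k l.
  (* The ball is not centred at [l], but it is open and contains [l]. *)
  have /ul[N _ Nu] : nbhs l (ball (c k i) k.+1%:R^-1).
    by apply: open_nbhs_nbhs; split => //; exact: open_metric_ball.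
  have /choice[g gP] := fun n => cnet k (u n).
  exists (i, mkseq g N) => n; rewrite /itinerary /=.
  have [nN|Nn] := ltnP n N; first by rewrite nth_mkseq.
  by rewrite nth_default ?size_mkseq//; exact: Nu.
have [y [_ uy]] : [set: X] `&` cluster (u @ \oo) !=set0.
  by apply: cX; exact: filterT.
apply/cvg_ex; exists y; apply/cvg_ballP => e e0.
(* One third for each step of the path from [y] to [u m], to the centre [c k p.1], to [u n]. *)
have e30 : 0 < e / 3 by rewrite divr_gt0.
have [k _ /(_ k (leqnn k)) /= ke] := near_infty_natSinv_lt (PosNum e30).
have [p pP] := up k.
have tail n : (size p.2 <= n)%N -> ball (c k p.1) (e / 3) (u n).
  move=> pn; apply: (le_ball (ltW ke)).
  by have := pP n; rewrite /itinerary nth_default.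
have [||_ [[m pm <-] yum]] := uy (u @` [set n | (size p.2 <= n)%N]) (ball y (e / 3)).
- by exists (size p.2) => // n pn; exists n.
- exact: nbhsx_ballx.
- exists (size p.2) => // n /= pn.
  have -> : e = e / 3 + (e / 3 + e / 3) by lra.
  apply: (ball_triangle yum); apply: ball_triangle (tail n pn).
  by apply: ball_sym; exact: tail.
Qed.

End MetricSpace.

Section Dynamics.
Context {R : realType} {X : pmetricType R}.
Context (f : {splitbij [set: X] >-> [set: X]}).
Implicit Types (z : X) (n : nat).

Lemma alpha_limit_cluster z :
  alpha_limit f z = cluster ((fun n => iterz f n%:Z z) @ \oo).
Proof. by apply/seteqP; split=> y /(subseq_limit_cluster (iterz f ^~ z) y). Qed.

Lemma omega_limit_cluster z :
  omega_limit f z = cluster ((fun n => iterz f (- n%:Z) z) @ \oo).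
Proof.
apply/seteqP; split=> [y [n noo ny]|y].
  apply/(subseq_limit_cluster (fun m => iterz f (- m) z) y).
  exists (fun j => - n j) => [m|].
    by near do rewrite lerNr; exact: noo.
  by under eq_fun do rewrite opprK.
move=> /(subseq_limit_cluster (fun m => iterz f (- m) z) y)[n noo ny].
exists (fun j => - n j) => // m.
by near do rewrite lerNl; exact: noo.
Unshelve. all: by end_near. Qed.

Lemma converging_semi_orbitsP z : compact [set: X] ->
  converging_semi_orbits f z <->
  cvg ((fun n => iterz f n%:Z z) @ \oo) /\
  cvg ((fun n => iterz f (- n%:Z) z) @ \oo).
Proof.
move=> cX; rewrite /converging_semi_orbits alpha_limit_cluster.
by rewrite omega_limit_cluster !cluster_set1_cvgn.
Qed.

Lemma iterz_continuous (m : int) : homeomorphism f -> continuous (iterz f m).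
Proof.
have iter_cts (g : X -> X) n : continuous g -> continuous (iter n g).
  move=> cg; elim: n => [|n IHn] x /=; first exact: cvg_id.
  exact: continuous_comp (IHn x) (cg _).
by case: m => n [cf cf1]; apply: iter_cts.
Qed.

Lemma int_nat_opp_ind (P : int -> Prop) :
  (forall n, P n%:Z) -> (forall n, P (- n%:Z)) -> forall m, P m.
Proof. by move=> P0 P1 [n|n] //; rewrite NegzE. Qed.

Definition shadow (c : nat -> X) (r : R) (p q : nat * seq nat) : set X :=
  [set z | forall n, ball (c (itinerary p n)) r (iterz f n%:Z z) /\
                     ball (c (itinerary q n)) r (iterz f (- n%:Z) z)].

(** A countable intersection of preimages of open balls under continuous iterates. *)
Lemma measurable_shadow c r p q : homeomorphism f ->
  measurable (shadow c r p q : set (borel X)).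
Proof.
move=> hf.
have mball (m : int) x : measurable (iterz f m @^-1` ball x r : set (borel X)).
  apply: sub_sigma_algebra.
  apply: open_comp; last exact: open_metric_ball.
  by move=> y _; exact: iterz_continuous.
rewrite [X in measurable X](_ : _ = \bigcap_n
   (iterz f n%:Z @^-1` ball (c (itinerary p n)) r `&`
    iterz f (- n%:Z) @^-1` ball (c (itinerary q n)) r)).
  by apply: bigcapT_measurable => n; exact: measurableI.
by apply/seteqP; split=> z zP n; [move=> _; exact: zP | exact: (zP n I)].
Qed.

(** At each time both orbits lie in the same ball of radius [r]. *)
Lemma shadow_close c r p q z w m : shadow c r p q z -> shadow c r p q w ->
  mdist (iterz f m z) (iterz f m w) < r + r.
Proof.
move=> zs ws; move: m; apply: int_nat_opp_ind => n;
  have [z1 z2] := zs n; have [w1 w2] := ws n.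
- by have := ball_triangle (ball_sym z1) w1; rewrite ballEmdist.
- by have := ball_triangle (ball_sym z2) w2; rewrite ballEmdist.
Qed.

Lemma converging_semi_orbits_shadow (c : nat -> nat -> X) :
  compact [set: X] -> (forall k y, exists i, ball (c k i) k.+1%:R^-1 y) ->
  [set z | converging_semi_orbits f z] =
  \bigcap_k \bigcup_(pq : (nat * seq nat) * (nat * seq nat))
     shadow (c k) k.+1%:R^-1 pq.1 pq.2.
Proof.
move=> cX cnet; apply/seteqP; split=> z.
  move=> /(converging_semi_orbitsP z cX)[].
  move=> /(cvgn_itinerary c _ cX cnet) zp /(cvgn_itinerary c _ cX cnet) zq k _.
  have [p pP] := zp k; have [q qP] := zq k.
  by exists (p, q) => // n; split.
move=> zpq; apply/(converging_semi_orbitsP z cX).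
by split; apply/(cvgn_itinerary c _ cX cnet) => k;
  have [[p q] _ pqP] := zpq k I; [exists p | exists q] => n; have [] := pqP n.
Qed.

End Dynamics.

Lemma negligible_square {d} {T : measurableType d} {R : realType}
    (mu : probability T R) (A : set T) : measurable A ->
  (mu \x mu)%E.-negligible (A `*` A) -> mu A = 0%E.
Proof.
move=> mA /(measure_negligible (measurableX mA mA)).
rewrite [LHS]product_measure1E// => /eqP.
by rewrite mule_eq0 orbb => /eqP.
Qed.

Lemma shadow_null {R : realType} {X : pmetricType R}
    {f : {splitbij [set: X] >-> [set: X]}} {mu : probability (borel X) R}
    {c : nat -> X} {r delta : R} {p q : nat * seq nat} :
  homeomorphism f -> r + r <= delta ->
  {ae (mu \x mu)%E, forall x : borel X * borel X,
     exists n : int, delta <= mdist (iterz f n x.1) (iterz f n x.2)} ->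
  mu (shadow f c r p q) = 0%E.
Proof.
move=> hf rdelta fsens.
apply: negligible_square; first exact: measurable_shadow.
(* The square avoids the pairs that separate by [delta], so it lies in the exceptional null set. *)
apply: negligibleS fsens => -[z w] [/= zs ws] [n].
by rewrite leNgt (lt_le_trans _ rdelta)//; exact: shadow_close zs ws.
Qed.

Theorem theorem2p7 (R : realType) (X : pmetricType R)
    (Xcompact : compact [set: X])
    (mu : probability (borel X) R)
    (f : {splitbij [set: X] >-> [set: X]})
    (fhomeo : homeomorphism f)
    (fsens : pairwise_sensitive f mu) :
  measurable ([set z | converging_semi_orbits f z] : set (borel X)) /\
  mu [set z | converging_semi_orbits f z] = 0%E.
Proof.
have /choice[c cnet] (k : nat) : exists c : nat -> X,
    forall y, exists i, ball (c i) k.+1%:R^-1 y.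
  by apply: compact_ball_net; rewrite ?invr_gt0.
rewrite (converging_semi_orbits_shadow f c Xcompact cnet).
have mU k : measurable (\bigcup_(pq : (nat * seq nat) * (nat * seq nat))
     shadow f (c k) k.+1%:R^-1 pq.1 pq.2 : set (borel X)).
  apply: countable_bigcupT_measurable => [|pq]; first exact: countableP.
  exact: measurable_shadow.
split; first exact: bigcapT_measurable.
have [delta delta0 sens] := fsens.
have d20 : 0 < delta / 2 by rewrite divr_gt0.
(* For nullity a single scale suffices, chosen so that twice its radius is at most [delta]. *)
have [k _ /(_ k (leqnn k)) /= /ltW kd] := near_infty_natSinv_lt (PosNum d20).
apply: measure_negligible; first exact: bigcapT_measurable.
apply: (negligibleS (bigcap_inf (i := k) I)).
(* The countable union is reindexed by [nat] to apply [negligible_bigcup]; numbers coding no pair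
   contribute the empty set. *)
rewrite (_ : \bigcup_pq _ = \bigcup_(i : nat)
  if choice.unpickle i is Some pq then shadow f (c k) k.+1%:R^-1 pq.1 pq.2 else set0).
  apply: negligible_bigcup => i; case: choice.unpickle => [pq|];
    last exact: negligible_set0.
  apply/negligibleP; first exact: measurable_shadow.
  by apply: (shadow_null fhomeo _ sens); rewrite [leRHS]splitr lerD.
apply/seteqP; split=> z [].
  by move=> pq _ zpq; exists (choice.pickle pq); rewrite ?choice.pickleK.
by move=> i _; case: choice.unpickle => // pq zpq; exists pq.
Qed.
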